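(* Let $\mathcal{H}$ be a complex separable Hilbert space and $A\in\mathcal{B}(\mathcal{H})$ with an orthonormal basis $\{e_j\}_{j\in J}$ of eigenvectors, $Ae_j=-\lambda_je_j$, where $\lambda_j\in\mathbb{C}_+$ for all $j$. Let $I$ be a countable index set and $g^i\in\mathcal{H}$ for $i\in I$. Let $B:=(I_{\mathcal{H}}+A)(I_{\mathcal{H}}-A)^{-1}\in\mathcal{B}(\mathcal{H})$, i.e. $Be_j=\mathfrak{h}(\lambda_j)e_j$, and let $a^i\in\mathcal{H}$ be defined by $\langle a^i,e_j\rangle=\frac{\sqrt2}{1+\lambda_j}\langle g^i,e_j\rangle$ for all $j$ (equivalently $a^i=\sqrt2(I_{\mathcal{H}}-A)^{-1}g^i$). Then $\{e^{tA}g^i\}_{i\in I,\,t\in[0,\infty)}$ is a semi-continuous frame for $\mathcal{H}$ if and only if $\{B^na^i\}_{i\in I,\,n\in\mathbb{N}\cup\{0\}}$ is a frame for $\mathcal{H}$.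
   Context: $\mathbb{C}_+=\{z:\mathrm{Re}\,z>0\}$, $\mathbb{D}=\{z:|z|<1\}$, and $\mathfrak{h}:\mathbb{D}\to\mathbb{C}_+$ (also $\mathbb{C}_+\to\mathbb{D}$), $\mathfrak{h}(z)=\frac{1-z}{1+z}$; $I_{\mathcal{H}}$ denotes the identity operator. $e^{tA}:=\sum_{n\ge0}\frac{t^n}{n!}A^n$. A countable family $\{f_k\}\subset\mathcal{H}$ is a frame if there are $c,C>0$ with $c\|f\|^2\le\sum_k|\langle f,f_k\rangle|^2\le C\|f\|^2$ for all $f\in\mathcal{H}$. For a countable $\mathcal{G}\subset\mathcal{H}$ and an interval $\mathcal{T}\subset[0,\infty)$, $\{e^{tA}g\}_{g\in\mathcal{G},t\in\mathcal{T}}$ is a semi-continuous frame for $\mathcal{H}$ if there are constants $c,C>0$ such that $c\|f\|^2\le\sum_{g\in\mathcal{G}}\int_{\mathcal{T}}|\langle f,e^{tA}g\rangle|^2\,dt\le C\|f\|^2$ for all $f\in\mathcal{H}$. *)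

(* Defs.v *)
From HB Require Import structures.
From mathcomp Require Import all_boot all_order all_algebra.
From mathcomp Require Import complex.
From mathcomp Require Import all_classical all_reals all_analysis.
Import Order.TTheory GRing.Theory Num.Theory.
Import numFieldNormedType.Exports.
Set Implicit Arguments. Unset Strict Implicit. Unset Printing Implicit Defensive.
Local Open Scope ring_scope.
Local Open Scope classical_set_scope.

(* A (complex) inner product on the normed space H inducing its norm:
   linear in the first argument, conjugate symmetric, and ||x||^2 = <x,x>.
   Together with H : completeNormedModType R[i] this makes H a complex
   Hilbert space. *)
Definition is_inner_product {R : realType} {H : normedModType R[i]}
  (ip : H -> H -> R[i]) : Prop :=
  [/\ forall (a : R[i]) (x y z : H), ip (a *: x + y) z = a * ip x z + ip y z,
      forall x y : H, ip y x = (ip x y)^*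
    & forall x : H, `|x| ^+ 2 = ip x x ].

Definition separable {R : realType} (H : normedModType R[i]) : Prop :=
  exists u : nat -> H, closure (range u) = [set: H].

(* bounded operator (A is assumed linear via its type) *)
Definition bounded_op {R : realType} {H : normedModType R[i]} (A : H -> H) : Prop :=
  exists M : R, forall x : H, `|A x| <= (M%:C)%C * `|x|.

Definition orthonormal_basis {R : realType} {H : normedModType R[i]}
  (ip : H -> H -> R[i]) (J : countType) (e : J -> H) : Prop :=
  (forall j k : J, ip (e j) (e k) = if j == k then 1 else 0) /\
  (forall x : H, (forall j, ip x (e j) = 0) -> x = 0).

Definition sqnorm {R : realType} {H : normedModType R[i]} (x : H) : R :=
  complex.Re (`|x| ^+ 2).

Definition expOp {R : realType} {H : normedModType R[i]} (A : H -> H) (t : R) (g : H) : H :=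
  limn (fun N : nat =>
    \sum_(0 <= n < N) (((t ^+ n / (n`!)%:R)%:C)%C *: iter n A g)).

Definition frame {R : realType} {H : normedModType R[i]}
  (ip : H -> H -> R[i]) (K : countType) (f : K -> H) : Prop :=
  exists c C : R, 0 < c /\ 0 < C /\
    forall x : H,
      ((c * sqnorm x)%:E <= \esum_(k in [set: K]) (complex.Re (`|ip x (f k)| ^+ 2))%:E
       <= (C * sqnorm x)%:E)%E.

Definition semi_continuous_frame {R : realType} {H : normedModType R[i]}
  (ip : H -> H -> R[i]) (A : H -> H) (I : countType) (g : I -> H) (T : set R) : Prop :=
  exists c C : R, 0 < c /\ 0 < C /\
    forall x : H,
      ((c * sqnorm x)%:E <=
         \esum_(i in [set: I])
            (\int[lebesgue_measure]_(t in T) (complex.Re (`|ip x (expOp A t (g i))| ^+ 2))%:E)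
       <= (C * sqnorm x)%:E)%E.

(* Main.v *)
Require Import Defs.
From HB Require Import structures.
From mathcomp Require Import all_boot all_order all_algebra.
From mathcomp Require Import complex.
From mathcomp Require Import all_classical all_reals all_analysis.
From mathcomp Require Import measurable_realfun.
From mathcomp Require Import ring lra.
Import Order.TTheory GRing.Theory Num.Theory.
Import numFieldNormedType.Exports.
Local Open Scope ring_scope.
Local Open Scope classical_set_scope.
Set Implicit Arguments. Unset Strict Implicit. Unset Printing Implicit Defensive.

(* The coefficients in the eigenbasis are <e^{tA} g, e_j> = e^{-t lam_j} <g, e_j> and
   <B^n a, e_j> = h(lam_j)^n sqrt 2 / (1 + lam_j) <g, e_j>.  For x in the span of finitely
   many e_j, both int |<x, e^{tA} g>|^2 dt and sum_n |<x, B^n a>|^2 then equal the Gram form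
   sum_{j,k} c_j conj(c_k) / (lam_j + conj(lam_k)),  c_j = conj <x, e_j> <g, e_j>:
   the first by the fundamental theorem of calculus, the second by telescoping.
   So the two frame quadratic forms agree on the partial sums x_N of the expansion of x.
   An upper bound passes from one form to the other by Fatou's lemma along x_N -> x; a lower
   bound passes by S(x_N) <= 2 S(x) + 2 S(x_N - x) and the upper bound applied to x_N - x,
   at the price of a smaller constant. *)

(** This is the squared modulus, spelled exactly as the integrand and the summand in the two frame
    definitions, so that those convert to expressions in [csq]. *)
Definition csq {R : realType} (z : R[i]) : R := complex.Re (`|z| ^+ 2).
Arguments csq : simpl never.

(** * Real parts, imaginary parts and squared moduli of complex numbers *)

Section ComplexParts.
Context {R : realType}.
Implicit Types z w : R[i].

Lemma csqE z : csq z = complex.Re z ^+ 2 + complex.Im z ^+ 2.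
Proof. by rewrite /csq -add_Re2_Im2. Qed.

Lemma ReD z w : complex.Re (z + w) = complex.Re z + complex.Re w.
Proof. by case: z w => [? ?] [? ?]. Qed.

Lemma ImD z w : complex.Im (z + w) = complex.Im z + complex.Im w.
Proof. by case: z w => [? ?] [? ?]. Qed.

Lemma ReN z : complex.Re (- z) = - complex.Re z.
Proof. by case: z. Qed.

Lemma ImN z : complex.Im (- z) = - complex.Im z.
Proof. by case: z. Qed.

Lemma ReM z w : complex.Re (z * w) =
  complex.Re z * complex.Re w - complex.Im z * complex.Im w.
Proof. by case: z w => [? ?] [? ?]. Qed.

Lemma ImM z w : complex.Im (z * w) =
  complex.Re z * complex.Im w + complex.Im z * complex.Re w.
Proof. by case: z w => [a b] [c d] /=; rewrite [b * c]mulrC. Qed.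

Lemma Re_conj z : complex.Re (conjc z) = complex.Re z.
Proof. by case: z. Qed.

Lemma Im_conj z : complex.Im (conjc z) = - complex.Im z.
Proof. by case: z. Qed.

Lemma eqc_ReIm z w :
  complex.Re z = complex.Re w -> complex.Im z = complex.Im w -> z = w.
Proof. by case: z w => [? ?] [? ?] /= -> ->. Qed.

Definition partsE := (ReD, ImD, ReN, ImN, ReM, ImM, Re_conj, Im_conj).

Lemma Re_sum (I : Type) (r : seq I) (P : pred I) (F : I -> R[i]) :
  complex.Re (\sum_(i <- r | P i) F i) = \sum_(i <- r | P i) complex.Re (F i).
Proof. exact: (big_morph _ ReD erefl). Qed.

Lemma csq_ge0 z : 0 <= csq z.
Proof. by rewrite csqE addr_ge0 ?sqr_ge0. Qed.

Lemma csqM z w : csq (z * w) = csq z * csq w.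
Proof. by rewrite !csqE !partsE; ring. Qed.

Lemma csq_conj z : csq (conjc z) = csq z.
Proof. by rewrite !csqE !partsE sqrrN. Qed.

Lemma csq0 : csq (0 : R[i]) = 0.
Proof. by rewrite csqE /= expr0n addr0. Qed.

Lemma csq1 : csq (1 : R[i]) = 1.
Proof. by rewrite csqE /= expr1n expr0n addr0. Qed.

Lemma csqN z : csq (- z) = csq z.
Proof. by rewrite !csqE !partsE !sqrrN. Qed.

Lemma csqD z w : csq (z + w) <= csq z *+ 2 + csq w *+ 2.
Proof.
rewrite !csqE !partsE.
have := sqr_ge0 (complex.Re z - complex.Re w).
have := sqr_ge0 (complex.Im z - complex.Im w).
by lra.
Qed.

Lemma mulc_conj z : z * conjc z = ((csq z)%:C)%C.
Proof. by rewrite csqE; apply: eqc_ReIm; rewrite !partsE /=; ring. Qed.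

Lemma csq_eq0 z : csq z = 0 -> z = 0.
Proof.
move=> /eqP; rewrite csqE paddr_eq0 ?sqr_ge0 // !sqrf_eq0 => /andP[/eqP h1 /eqP h2].
exact: eqc_ReIm.
Qed.

Lemma csqX z n : csq (z ^+ n) = csq z ^+ n.
Proof.
elim: n => [|n IH]; last by rewrite !exprS csqM IH.
by rewrite !expr0 csq1.
Qed.

Lemma csq_real (r : R) : csq ((r%:C)%C) = r ^+ 2.
Proof. by rewrite csqE /= expr0n addr0. Qed.

End ComplexParts.

(** * Inner products: orthogonality, Cauchy-Schwarz and convergence in norm *)

Section InnerProduct.
Context {R : realType} {H : normedModType R[i]} {ip : H -> H -> R[i]}.
Hypothesis Hip : is_inner_product ip.
Implicit Types x y z : H.

Lemma ip_lin (a : R[i]) x y z : ip (a *: x + y) z = a * ip x z + ip y z.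
Proof. by case: Hip. Qed.

Lemma ip_conj x y : ip y x = conjc (ip x y).
Proof. by case: Hip => _ h _; rewrite h. Qed.

Lemma ipDl x y z : ip (x + y) z = ip x z + ip y z.
Proof. by rewrite -{1}[x]scale1r ip_lin mul1r. Qed.

Lemma ip0l z : ip 0 z = 0.
Proof. by apply: (@addrI _ (ip 0 z)); rewrite -ipDl !addr0. Qed.

Lemma ipZl (a : R[i]) x z : ip (a *: x) z = a * ip x z.
Proof. by rewrite -[a *: x]addr0 ip_lin ip0l addr0. Qed.

Lemma ipNl x z : ip (- x) z = - ip x z.
Proof. by rewrite -scaleN1r ipZl mulN1r. Qed.

Lemma ipBl x y z : ip (x - y) z = ip x z - ip y z.
Proof. by rewrite ipDl ipNl. Qed.

Lemma ip_suml (I : Type) (r : seq I) (P : pred I) (F : I -> H) z :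
  ip (\sum_(i <- r | P i) F i) z = \sum_(i <- r | P i) ip (F i) z.
Proof. exact: (big_morph (fun x => ip x z) (fun x y => ipDl x y z) (ip0l z)). Qed.

Lemma ipDr x y z : ip z (x + y) = ip z x + ip z y.
Proof. by rewrite ip_conj ipDl rmorphD /= -!ip_conj. Qed.

Lemma ip0r z : ip z 0 = 0.
Proof. by rewrite ip_conj ip0l conjc0. Qed.

Lemma ipZr (a : R[i]) x z : ip z (a *: x) = conjc a * ip z x.
Proof. by rewrite ip_conj ipZl rmorphM /= -ip_conj. Qed.

Lemma ipxx x : ip x x = ((sqnorm x)%:C)%C.
Proof.
case: Hip => _ _ h; rewrite -h /sqnorm; apply/esym/RRe_real.
by rewrite ger0_real // exprn_ge0.
Qed.

Lemma sqnorm_normE x : sqnorm x = complex.Re `|x| ^+ 2.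
Proof.
have /RRe_real {1}<- : `|x| \is Num.real by rewrite ger0_real.
by rewrite /sqnorm -{1}[`|x|]RRe_real ?ger0_real // -rmorphXn.
Qed.

Lemma Re_norm_ge0 x : 0 <= complex.Re `|x|.
Proof. by have := normr_ge0 x; rewrite lecE => /andP[]. Qed.

Lemma sqnorm_ge0 x : 0 <= sqnorm x.
Proof. by rewrite sqnorm_normE sqr_ge0. Qed.

Lemma ipxx_eq0 x : ip x x = 0 -> x = 0.
Proof.
case: Hip => _ _ <- /eqP; rewrite expf_eq0 /= normr_eq0.
by move/eqP.
Qed.

Lemma sqnorm_eq0 x : sqnorm x = 0 -> x = 0.
Proof. by move=> h; apply: ipxx_eq0; rewrite ipxx h. Qed.

Lemma sqnorm0 : sqnorm (0 : H) = 0.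
Proof. by apply: complexI; rewrite -ipxx ip0l. Qed.

Lemma sqnormN x : sqnorm (- x) = sqnorm x.
Proof. by rewrite /sqnorm normrN. Qed.

Lemma sqnormBC x y : sqnorm (x - y) = sqnorm (y - x).
Proof. by rewrite -sqnormN opprB. Qed.

Lemma sqnorm_orthD x y : ip x y = 0 -> sqnorm (x + y) = sqnorm x + sqnorm y.
Proof.
move=> h; apply: complexI; rewrite rmorphD /= -!ipxx ipDl !ipDr h (ip_conj x y) h.
by rewrite conjc0 add0r addr0.
Qed.

Lemma sqnormZ (a : R[i]) x : sqnorm (a *: x) = csq a * sqnorm x.
Proof.
by apply: complexI; rewrite rmorphM /= -mulc_conj -!ipxx ipZl ipZr mulrA.
Qed.

(** Pythagoras for the decomposition of [sqnorm y *: x] into its component [v] along [y] and a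
    remainder [w] orthogonal to [y]; scaling [x] by [sqnorm y] avoids dividing by it. *)
Lemma cauchy_schwarz x y : csq (ip x y) <= sqnorm x * sqnorm y.
Proof.
have [y0|y0] := eqVneq (sqnorm y) 0.
  by rewrite (sqnorm_eq0 y0) ip0r csqE /= expr0n addr0 mulr_ge0 ?sqnorm_ge0.
have yp : 0 < sqnorm y by rewrite lt_neqAle eq_sym y0 sqnorm_ge0.
pose v := ip x y *: y; pose w := ((sqnorm y)%:C)%C *: x - v.
have vw : ip w v = 0.
  rewrite /w /v ipBl !ipZl !ipZr ipxx; apply/eqP.
  by rewrite subr_eq0; apply/eqP; ring.
have : sqnorm (w + v) = sqnorm w + sqnorm v by apply: sqnorm_orthD.
rewrite /w subrK !sqnormZ csq_real => h.
have : csq (ip x y) * sqnorm y <= sqnorm y ^+ 2 * sqnorm x.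
  by rewrite h lerDr sqnorm_ge0.
rewrite expr2 -mulrA mulrC ler_pM2l //.
by rewrite mulrC.
Qed.

(** The norm of [H] takes values in [R[i]]; this moves convergence to the real-valued [sqnorm],
    where order and squeeze arguments are available. *)
Lemma cvg_sqnorm (x_ : nat -> H) (y : H) :
  (sqnorm (x_ n - y) @[n --> \oo] --> (0 : R)) <-> (x_ n @[n --> \oo] --> y).
Proof.
split=> h.
  apply/cvgrPdist_lt => eps eps0.
  (* A positive element of [R[i]] has zero imaginary part, so [eps] is determined by its real
     part. *)
  have epsE : eps = ((complex.Re eps)%:C)%C by rewrite RRe_real // gtr0_real.
  have e0 : 0 < complex.Re eps by move: eps0; rewrite ltcE => /andP[].
  move/cvgrPdist_lt: h => /(_ (complex.Re eps ^+ 2)).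
  rewrite exprn_gt0 // => /(_ isT); apply: filterS => n /=.
  rewrite sub0r normrN ger0_norm ?sqnorm_ge0 // sqnormBC sqnorm_normE => h.
  have : complex.Re `|y - x_ n| < complex.Re eps.
    rewrite ltNge; apply/negP => le; move: h; rewrite ltNge => /negP; apply.
    by rewrite lerXn2r // nnegrE ?Re_norm_ge0 ?(ltW e0).
  by rewrite -ltcR -epsE RRe_real // ger0_real.
apply/cvgrPdist_lt => eps eps0.
pose e := Num.sqrt eps.
have e0 : 0 < e by rewrite sqrtr_gt0.
move/cvgrPdist_lt: h => /(_ ((e%:C)%C)).
rewrite ltcR => /(_ e0); apply: filterS => n /=.
rewrite sub0r normrN ger0_norm ?sqnorm_ge0 // sqnormBC sqnorm_normE.
rewrite ltcE => /andP[_ /= h].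
by rewrite -[ltRHS]sqr_sqrtr ?ltW // ltrXn2r ?nnegrE ?Re_norm_ge0 ?(ltW e0).
Qed.

(** Each part of a complex number is bounded by its modulus. The filter is arbitrary because both
    limits in [nat] and limits at [+oo] in [R] are taken later. *)
Lemma cvg_csq {T : Type} {F : set_system T} {FF : Filter F} (z_ : T -> R[i]) (z : R[i]) :
  (csq (z_ n - z) @[n --> F] --> (0 : R)) ->
  (complex.Re (z_ n) @[n --> F] --> complex.Re z) /\
  (complex.Im (z_ n) @[n --> F] --> complex.Im z).
Proof.
move=> h; split; apply/cvgrPdist_lt => eps eps0;
  (move/cvgrPdist_lt: h => /(_ (eps ^+ 2)); rewrite exprn_gt0 // => /(_ isT));
  apply: filterS => n /=; rewrite sub0r normrN ger0_norm ?csq_ge0 // csqE !partsE;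
  rewrite distrC => h; rewrite ltNge; apply/negP => le; move: h; rewrite ltNge => /negP; apply.
- apply: (@le_trans _ _ (`|complex.Re (z_ n) - complex.Re z| ^+ 2)).
    by rewrite lerXn2r // nnegrE (ltW eps0).
  by rewrite real_normK ?num_real // lerDl sqr_ge0.
- apply: (@le_trans _ _ (`|complex.Im (z_ n) - complex.Im z| ^+ 2)).
    by rewrite lerXn2r // nnegrE (ltW eps0).
  by rewrite real_normK ?num_real // lerDr sqr_ge0.
Qed.

Lemma cvg_ipl (x_ : nat -> H) x y : (x_ n @[n --> \oo] --> x) ->
  (csq (ip (x_ n) y - ip x y) @[n --> \oo] --> (0 : R)).
Proof.
move/cvg_sqnorm => h.
have h' : (sqnorm (x_ n - x) * sqnorm y) @[n --> \oo] --> (0 : R).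
  have := cvgMr_tmp (b := sqnorm y) h; rewrite mul0r; exact.
apply: (@squeeze_cvgr _ _ _ _ (fun=> 0) (fun n => sqnorm (x_ n - x) * sqnorm y)).
- by apply: nearW => n; rewrite csq_ge0 -ipBl cauchy_schwarz.
- exact: cvg_cst.
- exact: h'.
Qed.

End InnerProduct.

(** Completeness of [H], restated with a real tolerance and the real-valued [sqnorm]. *)
Lemma cauchy_sqnorm {R : realType} {H : completeNormedModType R[i]} (x_ : nat -> H) :
  (forall e : R, 0 < e -> exists N, forall m n, (N <= m)%N -> (N <= n)%N ->
     sqnorm (x_ m - x_ n) < e) ->
  exists y : H, x_ n @[n --> \oo] --> y.
Proof.
move=> h; apply/cvg_ex; apply/cauchy_cvgP/cauchyP => eps eps0.
have epsE : eps = ((complex.Re eps)%:C)%C by rewrite RRe_real // gtr0_real.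
have e0 : 0 < complex.Re eps by move: eps0; rewrite ltcE => /andP[].
have [|N hN] := h (complex.Re eps ^+ 2); first by rewrite exprn_gt0.
exists (x_ N); exists N => // n /= Nn.
have := hN _ _ (leqnn N) Nn; rewrite sqnorm_normE => lt.
rewrite -ball_normE /=.
have : complex.Re `|x_ N - x_ n| < complex.Re eps.
  rewrite ltNge; apply/negP => le; move: lt; rewrite ltNge => /negP; apply.
  by rewrite lerXn2r // nnegrE ?Re_norm_ge0 ?(ltW e0).
by rewrite -ltcR -epsE RRe_real // ger0_real.
Qed.

(** * Orthogonal expansions: Riesz-Fischer, Bessel and projections onto finite spans *)

Definition expansion {R : realType} {H : normedModType R[i]}
    (u : nat -> H) (c : nat -> R[i]) (N : nat) : H :=
  \sum_(0 <= n < N) c n *: u n.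

Section Expansions.
Context {R : realType} {H : completeNormedModType R[i]} {ip : H -> H -> R[i]}.
Hypothesis Hip : is_inner_product ip.
Variable u : nat -> H.
Hypothesis orth : forall m n, m != n -> ip (u m) (u n) = 0.
Hypothesis unit0 : forall n, ip (u n) (u n) = 1 \/ u n = 0.
Hypothesis total : forall x, (forall n, ip x (u n) = 0) -> x = 0.
Implicit Types (x : H) (c : nat -> R[i]).

(** Since [u n] is either a unit vector or zero, this says that [c n] vanishes wherever [u n] does.
    Zero vectors are allowed so that a finite basis, or one numbered with gaps, can be indexed by
    [nat]. *)
Definition adapted c := forall n, c n * ip (u n) (u n) = c n.

Lemma adapted_coef x : adapted (fun n => ip x (u n)).
Proof.
by move=> n; case: (unit0 n) => ->; rewrite ?mulr1 // (ip0r Hip) mul0r.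
Qed.

Lemma adaptedM c d : adapted c -> adapted (fun n => d n * c n).
Proof. by move=> h n; rewrite -mulrA h. Qed.

Lemma ip_expansion c N k : adapted c ->
  ip (expansion u c N) (u k) = if (k < N)%N then c k else 0.
Proof.
move=> hc; rewrite (ip_suml Hip).
rewrite (eq_bigr (fun n => if n == k then c k else 0)); last first.
  move=> n _; rewrite (ipZl Hip); case: eqP => [->|/eqP nk]; first exact: hc.
  by rewrite orth // mulr0.
by rewrite -big_mkcond big_nat1_eq.
Qed.

Lemma sqnorm_term c n : adapted c -> sqnorm (c n *: u n) = csq (c n).
Proof.
move=> hc; rewrite (sqnormZ Hip) -[sqnorm _]/(complex.Re (((sqnorm (u n))%:C)%C)).
rewrite -(ipxx Hip); case: (unit0 n) => [->|u0]; first by rewrite mulr1.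
have -> : c n = 0 by rewrite -hc u0 (ip0l Hip) mulr0.
by rewrite csqE /= expr0n addr0 mul0r.
Qed.

(** Pythagoras, adding one orthogonal term at a time. *)
Lemma sqnorm_expansionB c M N : adapted c -> (M <= N)%N ->
  sqnorm (expansion u c N - expansion u c M) = \sum_(M <= n < N) csq (c n).
Proof.
move=> hc MN; rewrite /expansion (@big_cat_nat _ _ _ M 0) //= addrAC subrr add0r.
elim: N MN => [|N IH]; first by rewrite leqn0 => /eqP ->; rewrite !big_geq // (sqnorm0 Hip).
rewrite leq_eqVlt => /predU1P[->|MN]; first by rewrite !big_geq // (sqnorm0 Hip).
rewrite !big_nat_recr //= (sqnorm_orthD Hip) ?IH ?sqnorm_term //.
rewrite (ip_suml Hip) big_nat big1 // => n /andP[_ nN].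
by rewrite (ipZl Hip) (ipZr Hip) orth ?mulr0 // ltn_eqF.
Qed.

Lemma expansion0 c : expansion u c 0 = 0.
Proof. exact: big_geq. Qed.

Lemma sqnorm_expansion c N : adapted c ->
  sqnorm (expansion u c N) = \sum_(0 <= n < N) csq (c n).
Proof. by move=> hc; rewrite -sqnorm_expansionB // expansion0 subr0. Qed.

(** The sums of [csq (c n)] increase and are bounded, hence Cauchy; by Pythagoras the expansions are
    Cauchy in [H], and completeness gives the limit. *)
Lemma riesz_fischer c (K : R) : adapted c ->
  (forall N, \sum_(0 <= n < N) csq (c n) <= K) ->
  exists2 y : H, expansion u c N @[N --> \oo] --> y & forall k, ip y (u k) = c k.
Proof.
move=> hc hK; pose s := series (fun n => csq (c n)).
have cs : cvgn s.
  apply: nondecreasing_is_cvgn.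
    apply/nondecreasing_seqP => n; rewrite /s /series /= big_nat_recr //=.
    by rewrite lerDl csq_ge0.
  by exists K => _ [n _ <-]; exact: hK.
have [y hy] : exists y : H, expansion u c n @[n --> \oo] --> y.
  apply: cauchy_sqnorm => e e0.
  move/cvg_cauchy: cs => /cauchyP /(_ (e / 2)); rewrite divr_gt0 // => /(_ isT) [l [N _ hN]].
  have main m n : (N <= m)%N -> (m <= n)%N -> sqnorm (expansion u c n - expansion u c m) < e.
    move=> Nm mn; rewrite sqnorm_expansionB //.
    have -> : \sum_(m <= k < n) csq (c k) = s n - s m.
      by rewrite /s /series /= [X in _ = X - _](@big_cat_nat _ _ _ m 0) //= addrAC subrr add0r.
    have := hN _ (leq_trans Nm mn); have := hN _ Nm.
    rewrite /ball /= /ball_ => h1 h2.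
    rewrite (le_lt_trans (ler_norm _)) //.
    have -> : s n - s m = (l - s m) - (l - s n) by ring.
    by rewrite (le_lt_trans (ler_normB _ _)) // [e]splitr ltrD.
  exists N => m n Nm Nn; case: (leqP m n) => mn; last exact: main (ltnW mn).
  by rewrite sqnormBC main.
exists y => // k; apply/eqP; rewrite -subr_eq0; apply/eqP/csq_eq0.
have h := cvg_ipl Hip (u k) hy.
(* The [k]-th coefficient of the expansion equals [c k] as soon as [N] exceeds [k], so the sequence
   that tends to 0 by [h] is also eventually constant. *)
have h' : csq (ip (expansion u c n) (u k) - ip y (u k)) @[n --> \oo] --> csq (ip y (u k) - c k).
  apply: cvg_near_cst; exists k.+1 => // n /= kn.
  by rewrite ip_expansion // kn -csqN opprB.
exact: (cvg_unique _ h' h).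
Qed.

Definition proj x N := expansion u (fun n => ip x (u n)) N.

Lemma proj_orth x N : ip (proj x N) (x - proj x N) = 0.
Proof.
rewrite {1}/proj /expansion (ip_suml Hip) big_nat big1 // => n /andP[_ nN].
rewrite (ipZl Hip) [X in _ * X](ip_conj Hip) (ipBl Hip) ip_expansion ?nN ?subrr ?conjc0 ?mulr0 //.
exact: adapted_coef.
Qed.

Lemma sqnorm_proj x N : sqnorm x = sqnorm (proj x N) + sqnorm (x - proj x N).
Proof. by rewrite -(sqnorm_orthD Hip) ?proj_orth // addrC subrK. Qed.

Lemma sqnorm_proj_le x N : sqnorm (proj x N) <= sqnorm x.
Proof. by rewrite (sqnorm_proj x N) lerDl sqnorm_ge0. Qed.

Lemma bessel x N : \sum_(0 <= n < N) csq (ip x (u n)) <= sqnorm x.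
Proof.
by rewrite -sqnorm_expansion ?sqnorm_proj_le //; exact: adapted_coef.
Qed.

Lemma coef_inj x y : (forall n, ip x (u n) = ip y (u n)) -> x = y.
Proof.
move=> h; apply/eqP; rewrite -subr_eq0; apply/eqP/total => n.
by rewrite (ipBl Hip) h subrr.
Qed.

(** Bessel and Riesz-Fischer give a limit with the same coefficients as [x]; totality identifies it
    with [x]. *)
Lemma cvg_proj x : proj x N @[N --> \oo] --> x.
Proof.
have [y hy yE] := riesz_fischer (adapted_coef x) (bessel x).
by rewrite -{2}(coef_inj yE).
Qed.

End Expansions.

Arguments adapted {R H} ip u c.
Arguments proj {R H} ip u x N.
Arguments cvg_proj {R H ip} Hip {u} orth unit0 total x.

(* The scalar exponential exp (z t) for complex z, given by the real power series of its
   real part and of its imaginary part. *)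
Section ScalarExponential.
Context {R : realType}.
Implicit Types (z w : R[i]) (t : R).

(** The multiplier [w] selects a real-linear functional of the complex series: 1 gives the real part
    and -i the imaginary part. Differentiation in [t] replaces [w] by [w * z], so one family of real
    series covers both parts and their derivatives. *)
Definition expc_coeff z w (n : nat) : R := complex.Re (w * z ^+ n) / n`!%:R.

Definition expc_part z w t : R := limn (pseries (expc_coeff z w) t).

(* Locked, so that [/=] does not unfold its real and imaginary parts. *)
Definition expc z t : R[i] :=
  locked (Complex (expc_part z 1 t) (expc_part z (- 'i%C) t)).

Lemma Re_expc z t : complex.Re (expc z t) = expc_part z 1 t.
Proof. by rewrite /expc -lock. Qed.

Lemma Im_expc z t : complex.Im (expc z t) = expc_part z (- 'i%C) t.
Proof. by rewrite /expc -lock. Qed.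

(** Comparison with |w| times the exponential series at |z| |t|, since a real part is bounded by the
    modulus. *)
Lemma is_cvg_expc_part z w t : cvgn (pseries (expc_coeff z w) t).
Proof.
apply: normed_cvg => /=.
apply: (@series_le_cvg _ _ (fun n => Num.sqrt (csq w) * exp_coeff (Num.sqrt (csq z) * `|t|) n)).
- by move=> n; exact: normr_ge0.
- by move=> n; rewrite mulr_ge0 ?sqrtr_ge0 // exp_coeff_ge0 // mulr_ge0 ?sqrtr_ge0.
- move=> n.
  have sX m : Num.sqrt (csq z) ^+ m = Num.sqrt (csq (z ^+ m)).
    elim: m => [|m IH]; last by rewrite !exprS csqM IH sqrtrM ?csq_ge0.
    by rewrite !expr0 csq1 sqrtr1.
  have -> : Num.sqrt (csq w) * exp_coeff (Num.sqrt (csq z) * `|t|) n =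
      Num.sqrt (csq (w * z ^+ n)) / n`!%:R * `|t| ^+ n.
    by rewrite csqM sqrtrM ?csq_ge0 // -sX /exp_coeff /= exprMn; ring.
  rewrite /expc_coeff /= !normrM normfV [`|n`!%:R|]ger0_norm // normrX.
  rewrite ler_wpM2r ?exprn_ge0 // ler_wpM2r ?invr_ge0 //.
  by rewrite -sqrtr_sqr ler_wsqrtr // csqE lerDl sqr_ge0.
- by apply: is_cvg_seriesZ; exact: is_cvg_series_exp_coeff.
Qed.

Lemma expc_coeff_diffs z w : pseries_diffs (expc_coeff z w) = expc_coeff z (w * z).
Proof.
apply/funext => n; rewrite /pseries_diffs /expc_coeff exprS mulrA factS natrM.
by rewrite invfM mulrCA mulVKf ?pnatr_eq0.
Qed.

Lemma is_derive_expc_part z w t :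
  is_derive t 1 (expc_part z w) (expc_part z (w * z) t).
Proof.
(* Termwise differentiation needs convergence at a point of larger modulus than [t]; the series
   converges everywhere, so [|t| + 1] serves. *)
rewrite /expc_part -expc_coeff_diffs; apply: (@pseries_snd_diffs _ _ (`|t| + 1));
  rewrite ?expc_coeff_diffs; try exact: is_cvg_expc_part.
by rewrite ltr_normr ltrDl ltr01.
Qed.

(** The series is real-linear in [w], so it is a combination of the cases 1 and -i. This turns the
    derivative with multiplier [w * z] into the expected formula for the derivative of exp (z t). *)
Lemma expc_partE z w t : expc_part z w t = complex.Re (w * expc z t).
Proof.
have h : pseries (expc_coeff z w) t N @[N --> \oo] --> complex.Re (w * expc z t).
  rewrite ReM Re_expc Im_expc.
  have -> : pseries (expc_coeff z w) t = (fun N => complex.Re w * pseries (expc_coeff z 1) t N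
      - complex.Im w * pseries (expc_coeff z (- 'i%C)) t N).
    apply/funext => N; rewrite /pseries /series /= !mulr_sumr -sumrB.
    by apply: eq_bigr => n _; rewrite /expc_coeff !partsE /=; ring.
  apply: cvgB; apply: cvgMl_tmp; exact: is_cvg_expc_part.
by have /(cvg_lim _) := h; apply.
Qed.

Lemma is_derive_Re_expc z t :
  is_derive t 1 (fun t => complex.Re (expc z t)) (complex.Re (z * expc z t)).
Proof.
have := is_derive_expc_part z 1 t; rewrite expc_partE mul1r.
by rewrite -(funext (Re_expc z)).
Qed.

Lemma is_derive_Im_expc z t :
  is_derive t 1 (fun t => complex.Im (expc z t)) (complex.Im (z * expc z t)).
Proof.
have := is_derive_expc_part z (- 'i%C) t; rewrite expc_partE -mulrA.
rewrite [complex.Re _]ReM /= !(mul0r, oppr0, mulN1r) sub0r opprK.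
by rewrite -(funext (Im_expc z)).
Qed.

Lemma expc0 z : expc z 0 = 1.
Proof.
have h w : expc_part z w 0 = complex.Re w.
  apply: (cvg_lim (@Rhausdorff R)); apply: cvg_near_cst; exists 1%N => // -[//|N] _ /=.
  rewrite /pseries /series /= big_nat_recl // big1 ?addr0.
    by rewrite expr0 mulr1 /expc_coeff expr0 mulr1 divr1.
  by move=> n _; rewrite expr0n mulr0.
by apply: eqc_ReIm; rewrite ?Re_expc ?Im_expc h //= oppr0.
Qed.

(** The product of |exp (z s)|^2 and exp (-2 Re z s) has zero derivative in [s] and value 1 at 0. *)
Lemma csq_expc z t : csq (expc z t) = expR (2 * complex.Re z * t).
Proof.
pose f (s : R) := csq (expc z s) * expR (- (2 * complex.Re z * s)).
have fE : f = fun s => (complex.Re (expc z s) ^+ 2 + complex.Im (expc z s) ^+ 2) *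
    expR (- (2 * complex.Re z) * s).
  by apply/funext => s; rewrite /f csqE mulNr.
have df s : is_derive s (1 : R) f 0.
  rewrite fE.
  have hr := is_derive_Re_expc z s.
  have hi := is_derive_Im_expc z s.
  apply: is_derive_eq.
  by rewrite /GRing.scale /= !partsE; ring.
have := is_derive_0_is_cst t 0 df.
rewrite /f expc0 mulr0 oppr0 expR0 csq1 mulr1 expRN.
by move/(canRL (divfK (lt0r_neq0 (expR_gt0 _)))); rewrite mul1r.
Qed.

Lemma csq_cvg (z_ : nat -> R[i]) z :
  (complex.Re (z_ n) @[n --> \oo] --> complex.Re z) ->
  (complex.Im (z_ n) @[n --> \oo] --> complex.Im z) ->
  (csq (z_ n - z) @[n --> \oo] --> (0 : R)).
Proof.
move=> hr hi.
under eq_fun do rewrite csqE !partsE.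
have -> : (0 : R) = (complex.Re z - complex.Re z) ^+ 2 + (complex.Im z - complex.Im z) ^+ 2.
  by rewrite !subrr expr0n addr0.
by apply: cvgD; apply: cvgM; apply: cvgB => //; exact: cvg_cst.
Qed.

Lemma csq_cvg_unique (z_ : nat -> R[i]) z w :
  (csq (z_ n - z) @[n --> \oo] --> (0 : R)) ->
  (csq (z_ n - w) @[n --> \oo] --> (0 : R)) -> z = w.
Proof.
move=> /cvg_csq[zr zi] /cvg_csq[wr wi].
by apply: eqc_ReIm; [exact: cvg_unique zr wr|exact: cvg_unique zi wi].
Qed.

(** The partial sums are written with the same scalars as in [expOp], so that coefficients of the
    operator series can be matched with them term by term. *)
Lemma cvg_expc z t :
  csq (\sum_(0 <= n < N) ((t ^+ n / n`!%:R)%:C)%C * z ^+ n - expc z t) @[N --> \oo] --> (0 : R).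
Proof.
have aux w N : pseries (expc_coeff z w) t N =
    complex.Re (w * \sum_(0 <= n < N) ((t ^+ n / n`!%:R)%:C)%C * z ^+ n).
  rewrite mulr_sumr Re_sum; apply: eq_bigr => n _.
  by rewrite mulrCA ReM /= mul0r subr0 /expc_coeff mulrC mulrA mulrAC.
apply: csq_cvg.
  have := @is_cvg_expc_part z 1 t.
  rewrite Re_expc /expc_part.
  have -> : pseries (expc_coeff z 1) t =
      fun N => complex.Re (\sum_(0 <= n < N) ((t ^+ n / n`!%:R)%:C)%C * z ^+ n).
    by apply/funext => N; rewrite aux mul1r.
  exact.
have := @is_cvg_expc_part z (- 'i%C) t.
rewrite Im_expc /expc_part.
have -> : pseries (expc_coeff z (- 'i%C)) t =
    fun N => complex.Im (\sum_(0 <= n < N) ((t ^+ n / n`!%:R)%:C)%C * z ^+ n).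
  by apply/funext => N; rewrite aux ReM /= !(mul0r, oppr0, mulN1r) sub0r opprK.
exact.
Qed.

End ScalarExponential.

(** * Eigenbasis coefficients of the operator exponential and of the Cayley transform *)

Section Operator.
Context {R : realType} {H : completeNormedModType R[i]} {ip : H -> H -> R[i]}.
Hypothesis Hip : is_inner_product ip.
Variable u : nat -> H.
Hypothesis orth : forall m n, m != n -> ip (u m) (u n) = 0.
Hypothesis unit0 : forall n, ip (u n) (u n) = 1 \/ u n = 0.
Hypothesis total : forall x, (forall n, ip x (u n) = 0) -> x = 0.
Variable A : {linear H -> H}.
Hypothesis Abd : bounded_op A.
Variable l : nat -> R[i].
Hypothesis Au : forall n, A (u n) = - l n *: u n.

(** A bounded linear functional that vanishes on every [u n] vanishes on the projections of [x],
    which converge to [x]. *)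
Lemma linear_eq0 (f : H -> R[i]) (K : R) :
  (forall x y, f (x + y) = f x + f y) -> (forall a x, f (a *: x) = a * f x) ->
  (forall x, csq (f x) <= K * sqnorm x) -> (forall n, f (u n) = 0) ->
  forall x, f x = 0.
Proof.
move=> fD fZ fK fu x.
have f0 : f 0 = 0 by rewrite -(scale0r 0) fZ mul0r.
have fp N : f (proj ip u x N) = 0.
  rewrite /proj /expansion (big_morph f fD f0) big1 // => n _.
  by rewrite fZ fu mulr0.
have := cvg_proj Hip orth unit0 total x => /cvg_sqnorm h.
apply/csq_eq0/eqP; rewrite eq_le csq_ge0 andbT.
have h1 : K * sqnorm (proj ip u x N - x) @[N --> \oo] --> (0 : R).
  by have := cvgMl_tmp (a := K) h; rewrite mulr0; exact.
rewrite -(cvg_lim (@Rhausdorff R) h1); apply: limr_ge; first by apply/cvg_ex; exists 0.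
apply: nearW => N; apply: le_trans (fK _).
have fN y : f (- y) = - f y by rewrite -scaleN1r fZ mulN1r.
by rewrite fD fp fN add0r csqN.
Qed.

Lemma bounded_opP : exists2 M : R, 0 <= M &
  forall x, complex.Re `|A x| <= M * complex.Re `|x|.
Proof.
have [M hM] := Abd; exists `|M| => // x.
have := hM x; rewrite lecE => /andP[_].
rewrite ReM /= mul0r subr0 => /le_trans; apply.
by rewrite ler_wpM2r ?Re_norm_ge0 ?ler_norm.
Qed.

(** The difference of the two sides is a bounded linear functional of [x], and it vanishes on every
    [u m] by the eigenvector equation and orthogonality. *)
Lemma ip_A x n : ip (A x) (u n) = - l n * ip x (u n).
Proof.
have [M M0 hM] := bounded_opP.
apply/eqP; rewrite -subr_eq0; apply/eqP.
(* The constant comes from |z + w|^2 <= 2 |z|^2 + 2 |w|^2, followed by Cauchy-Schwarz on each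
   term. *)
apply: (@linear_eq0 (fun x => ip (A x) (u n) - - l n * ip x (u n))
  (M ^+ 2 * sqnorm (u n) *+ 2 + csq (l n) * sqnorm (u n) *+ 2)) => {x}.
- by move=> x y; rewrite linearD !(ipDl Hip); ring.
- by move=> a x; rewrite linearZ /= !(ipZl Hip); ring.
- move=> x; rewrite mulNr opprK; apply: (le_trans (csqD _ _)).
  rewrite mulrDl !mulrnAl lerD // lerMn2r /=.
    apply: (le_trans (cauchy_schwarz Hip _ _)).
    rewrite mulrAC ler_wpM2r ?sqnorm_ge0 // !sqnorm_normE -exprMn.
    by rewrite lerXn2r ?nnegrE ?mulr_ge0 ?Re_norm_ge0.
  rewrite csqM -mulrA ler_wpM2l ?csq_ge0 // mulrC.
  exact: (cauchy_schwarz Hip).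
- move=> m; rewrite Au (ipZl Hip); case: (eqVneq m n) => [->|mn]; first by rewrite subrr.
  by rewrite orth // !mulr0 subrr.
Qed.

Lemma ip_iterA x n k : ip (iter k A x) (u n) = (- l n) ^+ k * ip x (u n).
Proof.
elim: k => [|k IH]; first by rewrite mul1r.
by rewrite iterS ip_A IH exprS mulrA.
Qed.

Lemma Re_norm_sum (I : Type) (r : seq I) (F : I -> H) :
  complex.Re `|\sum_(i <- r) F i| <= \sum_(i <- r) complex.Re `|F i|.
Proof.
have := ler_norm_sum r F xpredT; rewrite lecE => /andP[_].
by rewrite Re_sum.
Qed.

Lemma Re_normZ (a : R) (x : H) :
  complex.Re `|(a%:C)%C *: x| = `|a| * complex.Re `|x|.
Proof.
by rewrite normrZ ReM normc_def /= expr0n addr0 sqrtr_sqr mul0r subr0.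
Qed.

(** [expOp] is a [limn], which is meaningful only once convergence is known. Blocks of the series
    are dominated by those of the real exponential series at [|t| * M], hence it is Cauchy. *)
Lemma cvg_expOp t g :
  \sum_(0 <= n < N) (((t ^+ n / (n`!)%:R)%:C)%C *: iter n A g) @[N --> \oo] --> expOp A t g.
Proof.
have [M M0 hM] := bounded_opP.
set S := fun N => _.
suff [y hy] : exists y : H, S N @[N --> \oo] --> y.
  by rewrite /expOp -/S (cvg_lim _ hy) //; exact: norm_hausdorff.
have iterM n : complex.Re `|iter n A g| <= M ^+ n * complex.Re `|g|.
  elim: n => [|n IH]; first by rewrite mul1r.
  by rewrite iterS exprS -mulrA (le_trans (hM _)) // ler_wpM2l.
pose s := series (exp_coeff (`|t| * M)).
have sge m n : (m <= n)%N -> s n - s m = \sum_(m <= k < n) exp_coeff (`|t| * M) k.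
  by move=> mn; rewrite /s sub_series mn.
have main m n : (m <= n)%N ->
    complex.Re `|S n - S m| <= (s n - s m) * complex.Re `|g|.
  move=> mn; rewrite sge // /S (@big_cat_nat _ _ _ m 0) //= addrAC subrr add0r.
  rewrite (le_trans (Re_norm_sum _ _)) // mulr_suml ler_sum // => k _.
  rewrite Re_normZ /exp_coeff /= exprMn normrM normfV normrX [`|k`!%:R|]ger0_norm //.
  have -> : `|t| ^+ k * M ^+ k / k`!%:R * complex.Re `|g| =
    `|t| ^+ k / k`!%:R * (M ^+ k * complex.Re `|g|) by ring.
  by rewrite ler_wpM2l // divr_ge0.
apply: cauchy_sqnorm => e e0.
(* The added 1 keeps the divisor positive even when [g] is zero. *)
pose G := complex.Re `|g| + 1.
have G0 : 0 < G by rewrite ltr_wpDl ?Re_norm_ge0.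
pose d := Num.sqrt e / G.
have d0 : 0 < d by rewrite divr_gt0 ?sqrtr_gt0.
have /cvg_cauchy/cauchyP/(_ (d / 2)) : cvgn s by exact: is_cvg_series_exp_coeff.
rewrite divr_gt0 // => /(_ isT) [y [N _ hN]].
have main2 m n : (N <= m)%N -> (m <= n)%N -> sqnorm (S n - S m) < e.
  move=> Nm mn; rewrite sqnorm_normE -[ltRHS]sqr_sqrtr ?ltW //.
  rewrite ltrXn2r ?nnegrE ?Re_norm_ge0 ?sqrtr_ge0 //.
  apply: (le_lt_trans (main _ _ mn)).
  have : s n - s m < d.
    have := hN _ (leq_trans Nm mn); have := hN _ Nm.
    rewrite /ball /= /ball_ => h1 h2.
    rewrite (le_lt_trans (ler_norm _)) //.
    have -> : s n - s m = (y - s m) - (y - s n) by ring.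
    by rewrite (le_lt_trans (ler_normB _ _)) // [d]splitr ltrD.
  have snm : 0 <= s n - s m.
    rewrite sge // sumr_ge0 // => k _; rewrite exp_coeff_ge0 // mulr_ge0 //.
  rewrite /d ltr_pdivlMr // => h; apply: le_lt_trans h.
  by rewrite ler_wpM2l // /G lerDl.
exists N => m n Nm Nn; case: (leqP m n) => mn; last exact: main2 (ltnW mn).
by rewrite sqnormBC main2.
Qed.

(** Coefficients are continuous in the vector, so both sides are limits of the same partial sums of
    the scalar exponential series. *)
Lemma ip_expOp t g n : ip (expOp A t g) (u n) = expc (- l n) t * ip g (u n).
Proof.
apply: (csq_cvg_unique (cvg_ipl Hip (u n) (cvg_expOp (t := t) (g := g)))).

have h : csq (\sum_(0 <= k < N) ((t ^+ k / k`!%:R)%:C)%C * (- l n) ^+ k - expc (- l n) t)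
    * csq (ip g (u n)) @[N --> \oo] --> (0 : R).
  by have := cvgMr_tmp (b := csq (ip g (u n))) (cvg_expc (- l n) t); rewrite mul0r; exact.
apply: cvg_trans h; apply: near_eq_cvg; apply: nearW => N.
rewrite -csqM mulrBl (ip_suml Hip) mulr_suml; congr (csq (_ - _)).
by apply: eq_bigr => k _; rewrite (ipZl Hip) ip_iterA mulrA.
Qed.

Variable B : H -> H.
Hypothesis l0 : forall n, 0 < complex.Re (l n).
Hypothesis HB : forall x : H, B (x - A x) = x + A x.

Lemma addr1l_neq0 n : 1 + l n != 0.
Proof.
apply/eqP => h; have : complex.Re (1 + l n) = 0 by rewrite h.
by rewrite ReD /= => h'; have := l0 n; rewrite ltNge -(addr0 (_ (l n))) => /negP; apply; lra.
Qed.

Lemma csq_addr1l n : 1 <= csq (1 + l n).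
Proof.
rewrite csqE !partsE /=; have := l0 n; have := sqr_ge0 (0 + complex.Im (l n)).
by nra.
Qed.

(** [I - A] multiplies the [n]-th coefficient by [1 + l n], of modulus at least 1; dividing the
    coefficients of [y] by it keeps them square summable. Since [B] is specified only at vectors
    [x - A x], this makes its values accessible everywhere. *)
Lemma resolvent_surj y : exists x, x - A x = y.
Proof.
pose c n := (1 + l n)^-1 * ip y (u n).
have hc : adapted ip u c by apply: adaptedM; exact: adapted_coef.
have [|x _ hx] := riesz_fischer Hip orth unit0 (K := sqnorm y) hc.
  move=> N; apply: le_trans (bessel Hip orth unit0 y N); apply: ler_sum => n _.
  rewrite /c csqM ler_piMl ?csq_ge0 //.
  have h : csq ((1 + l n)^-1) * csq (1 + l n) = 1.
    by rewrite -csqM mulVf ?addr1l_neq0 // csq1.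
  rewrite -h ler_peMr ?csq_ge0 ?csq_addr1l //.
exists x; apply: (coef_inj Hip total) => n.
rewrite (ipBl Hip) ip_A hx /c.
have := addr1l_neq0 n => h; by field.
Qed.

(** Once the argument of [B] is written as [y - A y], its coefficient is [1 + l n] times that of
    [y], while the coefficient of the image is [1 - l n] times it. *)
Lemma ip_iterB x n k :
  ip (iter k B x) (u n) = ((1 - l n) / (1 + l n)) ^+ k * ip x (u n).
Proof.
elim: k => [|k IH]; first by rewrite mul1r.
rewrite iterS exprS -mulrA -IH; have [y <-] := resolvent_surj (iter k B x).
rewrite HB (ipDl Hip) (ipBl Hip) ip_A.
have := addr1l_neq0 n => h; by field.
Qed.

End Operator.

(** * The Gram form as an integral over the half-line and as a series *)

Section GramForm.
Context {R : realType}.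
Implicit Types (c l : nat -> R[i]) (N : nat).

(** The factor 1 / (l_j + conj l_k) is the inner product of the exponentials exp (-l_j t) and exp
    (-l_k t) in L^2 of the half-line. *)
Definition gram c l j k : R[i] := c j * conjc (c k) / (l j + conjc (l k)).

Definition gram_form c l N : R :=
  \sum_(0 <= j < N) \sum_(0 <= k < N) complex.Re (gram c l j k).

Lemma csq_sum c (e : nat -> R[i]) N : csq (\sum_(0 <= j < N) c j * e j) =
  \sum_(0 <= j < N) \sum_(0 <= k < N)
     complex.Re (c j * conjc (c k) * (e j * conjc (e k))).
Proof.
rewrite -[csq _]/(complex.Re ((csq (\sum_(0 <= j < N) c j * e j))%:C)%C) -mulc_conj.
rewrite rmorph_sum /= big_distrlr /= Re_sum; apply: eq_bigr => j _.
rewrite Re_sum; apply: eq_bigr => k _; rewrite rmorphM /=; congr complex.Re.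
exact: mulrACA.
Qed.

Lemma is_derive_big (f : nat -> R -> R) (df : nat -> R) (t : R) N :
  (forall k, is_derive t 1 (f k) (df k)) ->
  is_derive t 1 (fun s => \sum_(0 <= k < N) f k s) (\sum_(0 <= k < N) df k).
Proof.
move=> h; rewrite (_ : (fun s => _) = \sum_(k < N) f k).
  by rewrite big_mkord; apply: is_derive_sum.
by apply/funext => s; rewrite fct_sumE big_mkord.
Qed.

Lemma cvg_sum_seq {T J : Type} {F : set_system T} {FF : Filter F}
    (f : J -> T -> R) (a : J -> R) (s : seq J) :
  (forall k, f k x @[x --> F] --> a k) ->
  \sum_(k <- s) f k x @[x --> F] --> \sum_(k <- s) a k.
Proof.
move=> h; elim: s => [|i s IH].
  by under eq_fun do rewrite big_nil; rewrite big_nil; exact: cvg_cst.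
under eq_fun do rewrite big_cons.
by rewrite big_cons; apply: cvgD.
Qed.

Lemma cvg_sum0 {T : Type} {F : set_system T} {FF : Filter F} (f : nat -> T -> R) N :
  (forall k, f k x @[x --> F] --> (0 : R)) ->
  \sum_(0 <= k < N) f k x @[x --> F] --> (0 : R).
Proof.
by move=> h; have := cvg_sum_seq (s := index_iota 0 N) h; rewrite big1_eq; exact.
Qed.

(** Product rule for Re (G Z conj W), expanded into real coordinates so that the derivative is found
    by instance inference. *)
Lemma is_derive_mulJ (G Z W dZ dW : R[i]) (zr zi wr wi : R -> R) (t : R) :
  (zr t, zi t) = (complex.Re Z, complex.Im Z) ->
  (wr t, wi t) = (complex.Re W, complex.Im W) ->
  is_derive t 1 zr (complex.Re dZ) -> is_derive t 1 zi (complex.Im dZ) ->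
  is_derive t 1 wr (complex.Re dW) -> is_derive t 1 wi (complex.Im dW) ->
  is_derive t 1 (fun s => complex.Re G * (zr s * wr s + zi s * wi s)
     - complex.Im G * (zi s * wr s - zr s * wi s))
   (complex.Re (G * (dZ * conjc W + Z * conjc dW))).
Proof.
move=> [ezr ezi] [ewr ewi] h1 h2 h3 h4.
apply: is_derive_eq.
rewrite /GRing.scale /= ezr ezi ewr ewi !partsE; ring.
Qed.

Lemma is_derive_expcJ (G z w : R[i]) (t : R) :
  is_derive t 1 (fun t => complex.Re (G * (expc z t * conjc (expc w t))))
    (complex.Re (G * ((z + conjc w) * (expc z t * conjc (expc w t))))).
Proof.
have := is_derive_mulJ G (Z := expc z t) (W := expc w t) erefl erefl
  (is_derive_Re_expc z t) (is_derive_Im_expc z t)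
  (is_derive_Re_expc w t) (is_derive_Im_expc w t).
rewrite (_ : (fun s => _) = fun t => complex.Re (G * (expc z t * conjc (expc w t)))); last first.
  apply/funext => s; move: (expc z s) (expc w s) => Z W.
  by rewrite !partsE; ring.
congr (is_derive _ _ _ (complex.Re (G * _))).
by rewrite rmorphM /=; move: (expc z t) (conjc (expc w t)) => Z W; ring.
Qed.

(** The squared modulus is a constant times exp (-a t), with [a] positive because both real parts
    are negative. *)
Lemma cvg_expcJ (G z w : R[i]) : complex.Re z < 0 -> complex.Re w < 0 ->
  complex.Re (G * (expc z t * conjc (expc w t))) @[t --> +oo] --> (0 : R).
Proof.
move=> z0 w0; pose a := - (2 * (complex.Re z + complex.Re w)).
have a0 : 0 < a by rewrite /a; lra.
apply: (proj1 (@cvg_csq _ _ _ _ _ 0 _)).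
have e t : csq (G * (expc z t * conjc (expc w t)) - 0) = csq G * expR (- (a * t)).
  rewrite subr0 csqM csqM csq_conj !csq_expc -expRD; congr (_ * expR _).
  by rewrite /a; ring.
rewrite (funext e).
have h : expR (- (a * t)) @[t --> +oo] --> (0 : R).
  exact: (cvg_comp _ _ (gt0_cvgMry a0 cvg_id) (@cvgr_expR R)).
by have := cvgMl_tmp (a := csq G) h; rewrite mulr0; exact.
Qed.

Lemma Re_addc_conj_neq0 (z w : R[i]) :
  0 < complex.Re z -> 0 < complex.Re w -> z + conjc w != 0.
Proof.
move=> z0 w0; apply/eqP => h; have : complex.Re (z + conjc w) = 0 by rewrite h.
by rewrite !partsE; lra.
Qed.

Lemma continuous_csq_expc_sum c l N :
  continuous (fun t : R => csq (\sum_(0 <= k < N) c k * expc (- l k) t)).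
Proof.
move=> t; apply: differentiable_continuous; apply/derivable1_diffP.
rewrite (_ : (fun s => _) = fun s => \sum_(0 <= j < N) \sum_(0 <= k < N)
  complex.Re (c j * conjc (c k) * (expc (- l j) s * conjc (expc (- l k) s)))).
  apply: ex_derive; apply: is_derive_big => j; apply: is_derive_big => k.
  exact: is_derive_expcJ.
by apply/funext => s; rewrite csq_sum.
Qed.

Lemma integral_gram c l N : (forall n, 0 < complex.Re (l n)) ->
  (\int[lebesgue_measure]_(t in `[0%R, +oo[)
     (csq (\sum_(0 <= k < N) c k * expc (- l k) t))%:E = (gram_form c l N)%:E)%E.
Proof.
move=> l0.
(* An antiderivative of the integrand that vanishes at infinity: differentiation multiplies each
   term by -(l_j + conj l_k), which cancels the denominator in [gram]. Its value at 0 is minus the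
   Gram form. *)
pose q (t : R) := - \sum_(0 <= j < N) \sum_(0 <= k < N)
  complex.Re (gram c l j k * (expc (- l j) t * conjc (expc (- l k) t))).
pose f (t : R) := csq (\sum_(0 <= k < N) c k * expc (- l k) t).
have dq t : is_derive t (1 : R) q (f t).
  rewrite /f csq_sum -[X in is_derive _ _ _ X]opprK.
  apply: is_deriveN; rewrite -sumrN; apply: is_derive_big => j.
  rewrite -sumrN; apply: is_derive_big => k.
  rewrite -ReN; have := is_derive_expcJ (gram c l j k) (- l j) (- l k) t.
  set X := expc _ _ * _; congr (is_derive _ _ _ (complex.Re _)).
  rewrite rmorphN /= -opprD mulNr mulrN mulrA /gram divfK //.
  exact: Re_addc_conj_neq0.
have cf : continuous f by exact: continuous_csq_expc_sum.
rewrite (@ge0_continuous_FTC2y _ f q 0 0).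
- rewrite -EFinB sub0r /q opprK /gram_form; congr EFin.
  by apply: eq_bigr => j _; apply: eq_bigr => k _; rewrite !expc0 conjc1 !mulr1.
- by move=> t _; exact: csq_ge0.
- exact: continuous_subspaceT.
- rewrite -oppr0; apply: cvgN.
  apply: cvg_sum0 => j; apply: cvg_sum0 => k.
  by apply: cvg_expcJ; rewrite ReN oppr_lt0.
- by move=> t _; apply: ex_derive; exact: dq.
- apply: cvg_at_right_filter; apply: differentiable_continuous.
  by apply/derivable1_diffP; apply: ex_derive; exact: dq.
- by move=> t _; rewrite derive1E; apply: derive_val.
Qed.

(** The difference |1 + z|^2 - |1 - z|^2 equals 4 Re z. *)
Lemma csq_cayley_lt1 (z : R[i]) : 0 < complex.Re z -> csq ((1 - z) / (1 + z)) < 1.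
Proof.
move=> z0.
have h1 : 0 < csq (1 + z).
  by rewrite csqE !partsE /=; have := sqr_ge0 (0 + complex.Im z); nra.
have nz : 1 + z != 0 by apply: contraTneq h1 => ->; rewrite csq0 ltxx.
rewrite -(ltr_pM2r h1) -csqM divfK // mul1r.
by rewrite !csqE !partsE /=; nra.
Qed.

(** With h the Cayley transform, 1 - h(a) h(b) = 2 (a + b) / ((1 + a) (1 + b)). The conjugate
    quantities become independent variables [b] and [y], so this is an identity in any field; [x]
    and [y] stand for the [n]-th powers. *)
Lemma cayley_gram_step (F : fieldType) (a b s c x y : F) : s * s = 2 ->
  1 + a != 0 -> 1 + b != 0 -> a + b != 0 ->
  c * (s / (1 + a) * x * (s / (1 + b) * y)) =
  c / (a + b) * (x * y)
    - c / (a + b) * ((1 - a) / (1 + a) * x * ((1 - b) / (1 + b) * y)).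
Proof.
move=> s2 a0 b0 ab0.
have -> : c * (s / (1 + a) * x * (s / (1 + b) * y)) =
  c * (s * s) / (1 + a) * x / (1 + b) * y by field; rewrite a0 b0.
by rewrite s2; field; rewrite a0 b0 ab0.
Qed.

Lemma series_gram c l N : (forall n, 0 < complex.Re (l n)) ->
  (\sum_(n <oo) (csq (\sum_(0 <= k < N) c k *
      (((Num.sqrt 2)%:C)%C / (1 + l k) * ((1 - l k) / (1 + l k)) ^+ n)))%:E =
   (gram_form c l N)%:E)%E.
Proof.
move=> l0; pose h k := (1 - l k) / (1 + l k).
(* The discrete counterpart of an antiderivative: its increments are the terms of the series, and it
   tends to 0 because each |h_j| is below 1. *)
pose q n := - \sum_(0 <= j < N) \sum_(0 <= k < N)
  complex.Re (gram c l j k * (h j ^+ n * conjc (h k ^+ n))).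
set f := fun n => csq (\sum_(0 <= k < N) c k * (((Num.sqrt 2)%:C)%C / (1 + l k) * h k ^+ n)).
have fq n : f n = q n.+1 - q n.
  rewrite /f csq_sum /q opprK addrC -sumrB; apply: eq_bigr => j _.
  rewrite -sumrB; apply: eq_bigr => k _.
  rewrite -ReN -ReD; congr complex.Re.
  have hc i : conjc (h i) = (1 - conjc (l i)) / (1 + conjc (l i)).
    by rewrite /h rmorphM fmorphV rmorphB rmorphD rmorph1.
  have sc : conjc (((Num.sqrt 2)%:C)%C / (1 + l k)) = ((Num.sqrt 2)%:C)%C / (1 + conjc (l k)).
    by rewrite rmorphM fmorphV rmorphD rmorph1 /= oppr0.
  rewrite [conjc (_ * h k ^+ n)]rmorphM /= sc !rmorphXn /= hc !exprS {2}/h /gram.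
  have n1 : 1 + l j != 0.
    by have := @Re_addc_conj_neq0 (l j) 1 (l0 j); rewrite conjc1 addrC; apply; rewrite ltr01.
  have n2 : 1 + conjc (l k) != 0 by apply: Re_addc_conj_neq0; rewrite ?ltr01.
  have n3 : l j + conjc (l k) != 0 by apply: Re_addc_conj_neq0.
  have s2 : ((Num.sqrt 2)%:C)%C * ((Num.sqrt 2)%:C)%C = 2 :> R[i].
    by rewrite -rmorphM /= -expr2 sqr_sqrtr // rmorphMn.
  exact: cayley_gram_step.
have q0 : q n @[n --> \oo] --> (0 : R).
  rewrite -oppr0; apply: cvgN.
  apply: cvg_sum0 => j; apply: cvg_sum0 => k.
  apply: (proj1 (@cvg_csq _ _ _ _ _ 0 _)).
  have e n : csq (gram c l j k * (h j ^+ n * conjc (h k ^+ n)) - 0) =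
      csq (gram c l j k) * (csq (h j) * csq (h k)) ^+ n.
    by rewrite subr0 csqM [csq (_ ^+ _ * _)]csqM csq_conj !csqX exprMn.
  rewrite (funext e).
  rewrite -(mulr0 (csq (gram c l j k))).
  apply: cvgMl_tmp; apply: cvg_expr.
  rewrite ger0_norm ?mulr_ge0 ?csq_ge0 //.
  by rewrite mulr_ilt1 ?csq_ge0 // csq_cayley_lt1.
apply: (cvg_lim (@ereal_hausdorff R)).
have -> : gram_form c l N = 0 - q 0%N.
  rewrite sub0r /q opprK /gram_form.
  by apply: eq_bigr => j _; apply: eq_bigr => k _; rewrite !expr0 conjc1 !mulr1.
have h1 : (q n - q 0%N)%:E @[n --> \oo] --> (0 - q 0%N)%:E.
  by apply: cvg_EFin; [exact: nearW|apply: cvgB => //; exact: cvg_cst].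
apply: cvg_trans h1; apply: near_eq_cvg; apply: nearW => n.
rewrite sumEFin; congr EFin; rewrite -telescope_sumr //.
by apply: eq_bigr => k _; rewrite -fq.
Qed.

End GramForm.

(** * Sums of integrals of nonnegative functions: quasi-additivity and lower semicontinuity *)

Section FrameForm.
Context d (T : measurableType d) {R : realType} (mu : {measure set T -> \bar R}).
Context (D : set T) (mD : measurable D) (I : countType) {H : zmodType}.
Variable phi : I -> H -> T -> R.
Hypothesis phi_ge0 : forall i x t, 0 <= phi i x t.
Hypothesis phi_meas : forall i x, measurable_fun D (phi i x).
Local Open Scope ereal_scope.

(** Lebesgue measure on the half-line gives the semi-continuous form and counting measure on [nat]
    the discrete one, so the estimates are proved once for both. *)
Definition frame_form (x : H) : \bar R :=
  \esum_(i in [set: I]) \int[mu]_(t in D) (phi i x t)%:E.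

Lemma frame_form_ge0 x : 0 <= frame_form x.
Proof.
by apply: esum_ge0 => i _; apply: integral_ge0 => t _; rewrite lee_fin.
Qed.

Lemma frame_formD x y :
  (forall i t, (phi i (x + y) t <= phi i x t *+ 2 + phi i y t *+ 2)%R) ->
  frame_form (x + y)%R <=
    (frame_form x + frame_form x) + (frame_form y + frame_form y).
Proof.
move=> h.
have i0 i z : 0 <= \int[mu]_(t in D) (phi i z t)%:E.
  by apply: integral_ge0 => t _; rewrite lee_fin.
have mE i z : measurable_fun D (EFin \o phi i z) by exact/measurable_EFinP.
have m2 i z : measurable_fun D ((EFin \o phi i z) \+ (EFin \o phi i z)).
  exact: emeasurable_funD.
rewrite /frame_form -!esumD; try by move=> *; do ?[exact: i0 | apply: adde_ge0].
apply: le_esum => i _.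
rewrite -!ge0_integralD //; try exact: mE; try exact: m2;
  try by move=> *; do ?[rewrite lee_fin; exact: phi_ge0 | apply: adde_ge0].
apply: ge0_le_integral => //.
- by move=> *; rewrite lee_fin.
- exact: mE.
- apply: emeasurable_funD; exact: m2.
- by move=> t _; rewrite -!EFinD lee_fin -!mulr2n.
Qed.

(** The sum over [I] is a supremum over finite subsets, so it suffices to apply Fatou's lemma to
    each finite subsum. *)
Lemma frame_form_lsc (x_ : nat -> H) x (K : R) :
  (forall i t, D t -> phi i (x_ n) t @[n --> \oo] --> phi i x t) ->
  (forall n, frame_form (x_ n) <= K%:E) -> frame_form x <= K%:E.
Proof.
move=> hcvg hK; apply: ge_ereal_sup => _ [F [finF _] <-].
have mE i z : measurable_fun D (EFin \o phi i z) by exact/measurable_EFinP.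
rewrite -ge0_integral_fsum //; last 2 first.
- by move=> i; exact: mE.
- by move=> i t _; rewrite lee_fin.
have msum z : measurable_fun D (fun t => \sum_(i \in F) (phi i z t)%:E : \bar R).
  under eq_fun do rewrite fsbig_finite //=.
  by apply: emeasurable_sum => i; exact: mE.
pose f n t := \sum_(i \in F) (phi i (x_ n) t)%:E.
(* Pointwise convergence rewrites the integrand as a lower limit, the shape in which Fatou's lemma
   applies. *)
have -> : \int[mu]_(t in D) \sum_(i \in F) (phi i x t)%:E =
    \int[mu]_(t in D) limn_einf (f^~ t).
  apply: eq_integral => t; rewrite inE => Dt.
  apply/esym/(cvg_limn_einf_sup _).1.
  rewrite /f; under eq_fun do rewrite fsbig_finite //= sumEFin.
  rewrite fsbig_finite //= sumEFin.
  by apply: cvg_EFin; [exact: nearW | apply: cvg_sum_seq => i; exact: hcvg].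
apply: (le_trans (fatou mu mD (fun n => msum (x_ n)) _)).
  by move=> n t _; apply: fsume_ge0 => i _; rewrite lee_fin.
rewrite limn_einf_lim; apply: lime_le; first exact: is_cvg_einfs.
apply: nearW => n; apply: le_trans (hK n).
apply: (@le_trans _ _ (\int[mu]_(t in D) f n t)).
  by apply: ereal_inf_lbound; exists n => /=.
rewrite ge0_integral_fsum //; last 2 first.
- by move=> i; exact: mE.
- by move=> i t _; rewrite lee_fin.
by apply: ereal_sup_ubound; exists F.
Qed.

End FrameForm.

(** * Transfer of frame bounds between forms that agree on approximants *)

Section Transfer.
Context {R : realType} {H : normedModType R[i]}.
Implicit Types S : H -> \bar R.

Definition frame_bounds S := exists c C : R, 0 < c /\ 0 < C /\
  forall x : H, ((c * sqnorm x)%:E <= S x <= (C * sqnorm x)%:E)%E.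

(** The approximants [p x N] stand for the projections of [x]. The upper constant survives
    unchanged, since projections do not increase the norm; the lower one drops from [c] to
    [c / 4]. *)
Lemma frame_bounds_transfer S1 S2 (p : H -> nat -> H) :
  (forall x, (0 <= S2 x)%E) ->
  (forall x y, (S2 (x + y)%R <= (S2 x + S2 x) + (S2 y + S2 y))%E) ->
  (forall x (K : R), (forall N, (S2 (p x N) <= K%:E)%E) -> (S2 x <= K%:E)%E) ->
  (forall x N, S1 (p x N) = S2 (p x N)) ->
  (forall x N, sqnorm x = sqnorm (p x N) + sqnorm (x - p x N)) ->
  (forall x, sqnorm (p x N - x) @[N --> \oo] --> (0 : R)) ->
  frame_bounds S1 -> frame_bounds S2.
Proof.
move=> S2_ge0 S2D S2lsc S12 pyth pcvg [c [C [c0 [C0 h1]]]].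
have up x : (S2 x <= (C * sqnorm x)%:E)%E.
  apply: S2lsc => N; rewrite -S12.
  have /andP[_ /le_trans] := h1 (p x N); apply.
  by rewrite lee_fin ler_wpM2l ?(ltW C0) // (pyth x N) lerDl sqnorm_ge0.
exists (c / 4), C; split; first by rewrite divr_gt0.
split=> // x; rewrite up andbT.
have fS y : S2 y \is a fin_num.
  rewrite ge0_fin_numE //; exact: le_lt_trans (up y) (ltry _).
have [x0|x0] := eqVneq (sqnorm x) 0; first by rewrite x0 mulr0 S2_ge0.
have xp : 0 < sqnorm x by rewrite lt_neqAle eq_sym x0 sqnorm_ge0.
(* With X = |x|^2 and d = |p x N - x|^2, the bounds give c (X - d) <= 2 S2(x) + 2 C d. As d < [del]
   means (2 C + c) d < c X / 2, it follows that S2(x) > c X / 4. *)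
pose del := c * sqnorm x / (2 * (2 * C + c)).
have del0 : 0 < del by rewrite divr_gt0 ?mulr_gt0 ?addr_gt0 ?mulr_gt0.
move/cvgrPdist_lt: (pcvg x) => /(_ _ del0) [N _ /(_ N (leqnn N))] /=.
rewrite sub0r normrN ger0_norm ?sqnorm_ge0 // => hN.
have /andP[lo _] := h1 (p x N).
have lo2 : ((c * sqnorm (p x N))%:E <= (S2 x + S2 x) + (S2 (p x N - x)%R + S2 (p x N - x)%R))%E.
  by apply: (le_trans lo); rewrite S12 -{1}[p x N](subrK x) [X in S2 X]addrC.
move: lo2 (up (p x N - x)).
rewrite -(fineK (fS x)) -(fineK (fS (p x N - x))) -!EFinD !lee_fin.
have := pyth x N; rewrite (sqnormBC x).
move: hN; rewrite /del ltr_pdivlMr; last by rewrite mulr_gt0 ?addr_gt0 ?mulr_gt0.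
move: (fine _) (fine _) => r s hN xE lo2 up2.
rewrite xE in hN *; lra.
Qed.

End Transfer.

Lemma cvg_csq_ip {R : realType} {H : normedModType R[i]} (ip : H -> H -> R[i])
    (x_ : nat -> H) (x y : H) : is_inner_product ip ->
  x_ n @[n --> \oo] --> x -> csq (ip (x_ n) y) @[n --> \oo] --> csq (ip x y).
Proof.
move=> Hip h; have [hr hi] := cvg_csq (cvg_ipl Hip y h).
rewrite csqE; under eq_fun do rewrite csqE.
by apply: cvgD; apply: cvgM.
Qed.

(** * Equality of the two frame forms on projections, and equivalence of their bounds *)

Section CayleyFrame.
Context {R : realType} {H : completeNormedModType R[i]} {ip : H -> H -> R[i]}.
Hypothesis Hip : is_inner_product ip.
Variable u : nat -> H.
Hypothesis orth : forall m n, m != n -> ip (u m) (u n) = 0.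
Hypothesis unit0 : forall n, ip (u n) (u n) = 1 \/ u n = 0.
Hypothesis total : forall x, (forall n, ip x (u n) = 0) -> x = 0.
Variable A : {linear H -> H}.
Hypothesis Abd : bounded_op A.
Variable l : nat -> R[i].
Hypothesis Au : forall n, A (u n) = - l n *: u n.
Hypothesis l0 : forall n, 0 < complex.Re (l n).
Variable B : H -> H.
Hypothesis HB : forall x : H, B (x - A x) = x + A x.
Variables (I : countType) (g a : I -> H).
Hypothesis Ha : forall i n,
  ip (a i) (u n) = ((Num.sqrt 2)%:C)%C / (1 + l n) * ip (g i) (u n).

Let gcoef i x n := conjc (ip x (u n)) * ip (g i) (u n).

(** Conjugating inside [csq] puts [y] in the first slot of [ip], where the coefficients of orbit
    vectors have been computed. *)
Lemma csq_ip_proj x y N : csq (ip (proj ip u x N) y) =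
  csq (\sum_(0 <= k < N) conjc (ip x (u k)) * ip y (u k)).
Proof.
rewrite -csq_conj /proj /expansion (ip_suml Hip) rmorph_sum /=; congr csq.
by apply: eq_bigr => k _; rewrite (ipZl Hip) rmorphM /= (ip_conj Hip (u k) y).
Qed.

Lemma csq_ip_expOp_proj i x t N : csq (ip (proj ip u x N) (expOp A t (g i))) =
  csq (\sum_(0 <= k < N) gcoef i x k * expc (- l k) t).
Proof.
rewrite csq_ip_proj; congr csq; apply: eq_bigr => k _.
by rewrite (ip_expOp Hip orth unit0 total Abd Au) /gcoef [expc _ _ * _]mulrC mulrA.
Qed.

Lemma csq_ip_iter_proj i x n N : csq (ip (proj ip u x N) (iter n B (a i))) =
  csq (\sum_(0 <= k < N) gcoef i x k *
    (((Num.sqrt 2)%:C)%C / (1 + l k) * ((1 - l k) / (1 + l k)) ^+ n)).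
Proof.
rewrite csq_ip_proj; congr csq; apply: eq_bigr => k _.
rewrite (ip_iterB Hip orth unit0 total Abd Au l0 HB) Ha /gcoef.
by rewrite -[RHS]mulrA; congr (_ * _); rewrite mulrC mulrAC mulrC.
Qed.

Definition phi_exp i x (t : R) := csq (ip x (expOp A t (g i))).
Definition phi_iter i x (n : nat) := csq (ip x (iter n B (a i))).

(** Along the projections of [x] the function is continuous in [t]; the general case is their
    pointwise limit. *)
Lemma measurable_phi_exp i x (D : set R) : measurable D ->
  measurable_fun D (phi_exp i x).
Proof.
move=> mD.
apply: (@measurable_fun_cvg _ _ _ D (fun N => phi_exp i (proj ip u x N))).
  move=> N; apply: measurable_funTS.
  rewrite (_ : phi_exp _ _ = fun t => csq (\sum_(0 <= k < N) gcoef i x k * expc (- l k) t)).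
    by apply: continuous_measurable_fun; exact: continuous_csq_expc_sum.
  by apply/funext => t; exact: csq_ip_expOp_proj.
by move=> t _; apply: (@cvg_csq_ip _ _ ip (proj ip u x)) => //; exact: (cvg_proj Hip orth unit0 total x).
Qed.

Let form_exp := frame_form lebesgue_measure `[0%R, +oo[ phi_exp.
Let form_iter := frame_form counting [set: nat] phi_iter.

(** For each [i], both the integral and the series equal the Gram form with coefficients
    [gcoef i x]. *)
Lemma form_exp_proj x N : form_exp (proj ip u x N) = form_iter (proj ip u x N).
Proof.
apply: eq_esum => i _.
rewrite ge0_integral_count; last by move=> n; rewrite lee_fin csq_ge0.
under eq_integral do rewrite /phi_exp csq_ip_expOp_proj.
under eq_eseriesr do rewrite /phi_iter csq_ip_iter_proj.
by rewrite integral_gram // series_gram.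
Qed.

Lemma frame_bounds_exp_iter : frame_bounds form_exp <-> frame_bounds form_iter.
Proof.
have cvgp x : sqnorm (proj ip u x N - x) @[N --> \oo] --> (0 : R).
  by apply/cvg_sqnorm; exact: (cvg_proj Hip orth unit0 total x).
split; apply: (@frame_bounds_transfer _ _ _ _ (proj ip u)) => //.
- by move=> x; apply: frame_form_ge0 => *; exact: csq_ge0.
- move=> x y; apply: frame_formD => // [*|i t]; first exact: csq_ge0.
  by rewrite /phi_iter (ipDl Hip) csqD.
- move=> x K; apply: frame_form_lsc => // [*|i t _]; first exact: csq_ge0.
  by apply: (@cvg_csq_ip _ _ ip (proj ip u x)) => //; exact: (cvg_proj Hip orth unit0 total x).
- exact: form_exp_proj.
- exact: (sqnorm_proj Hip orth unit0).
- by move=> x; apply: frame_form_ge0 => *; exact: csq_ge0.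
- move=> x y; apply: frame_formD => // [*|*|i t]; [exact: csq_ge0|exact: measurable_phi_exp|].
  by rewrite /phi_exp (ipDl Hip) csqD.
- move=> x K; apply: frame_form_lsc => // [*|*|i t _]; [exact: csq_ge0|exact: measurable_phi_exp|].
  by apply: (@cvg_csq_ip _ _ ip (proj ip u x)) => //; exact: (cvg_proj Hip orth unit0 total x).
- by move=> x N; rewrite form_exp_proj.
- exact: (sqnorm_proj Hip orth unit0).
Qed.

Lemma semi_continuous_frame_bounds :
  semi_continuous_frame ip A g `[0, +oo[ <-> frame_bounds form_exp.
Proof. by []. Qed.

(** The sum over pairs is split into an iterated sum of nonnegative terms, whose inner sum is an
    integral against counting measure. *)
Lemma frame_iter_bounds :
  frame ip (fun p : I * nat => iter p.2 B (a p.1)) <-> frame_bounds form_iter.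
Proof.
rewrite /frame /frame_bounds.
suff e x : (\esum_(k in [set: I * nat])
    (complex.Re (`|ip x (iter k.2 B (a k.1))| ^+ 2))%:E = form_iter x)%E.
  by split=> -[c [C [c0 [C0 h]]]]; exists c, C; do 2?split => //; move=> x;
    have := h x; rewrite e.
rewrite /form_iter /frame_form.
have -> : [set: I * nat] = [set: I] `*`` (fun=> [set: nat]) by apply/seteqP; split.
rewrite -(@esum_esum _ _ _ _ _ (fun i n => (phi_iter i x n)%:E)); last first.
  by move=> *; rewrite lee_fin csq_ge0.
apply: eq_esum => i _; rewrite ge0_integral_count ?nneseries_esumT //;
  by move=> n; rewrite lee_fin csq_ge0.
Qed.

End CayleyFrame.

(** * Reduction of a countable eigenbasis to a sequence indexed by the natural numbers *)

Unset Implicit Arguments.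

Theorem mainTheorem9 (R : realType) (H : completeNormedModType R[i])
  (ip : H -> H -> R[i]) (Hip : is_inner_product ip) (Hsep : separable H)
  (A : {linear H -> H}) (Abd : bounded_op A)
  (J : countType) (e : J -> H) (lam : J -> R[i])
  (He : orthonormal_basis ip e)
  (Hlam : forall j, 0 < complex.Re (lam j))
  (Heig : forall j, A (e j) = - lam j *: e j)
  (I : countType) (g : I -> H) (B : H -> H) (a : I -> H)
  (HB : forall x : H, B (x - A x) = x + A x)
  (Ha : forall i j, ip (a i) (e j) = ((Num.sqrt 2)%:C)%C / (1 + lam j) * ip (g i) (e j)) :
  semi_continuous_frame ip A g `[0, +oo[
  <-> frame ip (fun p : I * nat => iter p.2 B (a p.1)).
Proof.
case: He => orthE totalE.
(* The basis reindexed by [nat]: gaps in the numbering of [J] are filled with the zero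
   vector and the dummy eigenvalue 1. *)
pose u n := if pickle_inv n is Some j then e j else 0.
pose l n := if pickle_inv n is Some j then lam j else 1.
have orth m n : m != n -> ip (u m) (u n) = 0.
  rewrite /u; have := pickle_invK (T := J) m; have := pickle_invK (T := J) n.
  case: (pickle_inv m) => [j|]; case: (pickle_inv n) => [k|] //=;
    rewrite ?(ip0l Hip) ?(ip0r Hip) // => <- <- mn.
  (* Here [m] and [n] are the codes of [j] and [k], so [j = k] would contradict [m != n]. *)
  by rewrite orthE; case: (eqVneq j k) mn => // ->; rewrite eqxx.
have unit0 n : ip (u n) (u n) = 1 \/ u n = 0.
  rewrite /u; case: (pickle_inv n) => [j|]; last by right.
  by left; rewrite orthE eqxx.
have total x : (forall n, ip x (u n) = 0) -> x = 0.
  move=> h; apply: totalE => j; have := h (pickle j).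
  by rewrite /u pickleK_inv.
have l0 n : 0 < complex.Re (l n).
  by rewrite /l; case: (pickle_inv n) => [j|] //=; exact: ltr01.
have Au n : A (u n) = - l n *: u n.
  by rewrite /u /l; case: (pickle_inv n) => [j|]; rewrite ?Heig // linear0 scaler0.
have Hau i n : ip (a i) (u n) = ((Num.sqrt 2)%:C)%C / (1 + l n) * ip (g i) (u n).
  by rewrite /u /l; case: (pickle_inv n) => [j|]; rewrite ?Ha // !(ip0r Hip) mulr0.
apply: (iff_trans (semi_continuous_frame_bounds (ip := ip) A g)).
apply: iff_trans (iff_sym (frame_iter_bounds (ip := ip) B a)).
exact: (frame_bounds_exp_iter Hip orth unit0 total Abd Au l0 HB Hau).
Qed.
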